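(* For $n\ge 2$ let $\mathcal A_n=\langle \mathbf S_1,\dots,\mathbf S_{n+2}\rangle\subset GL(n+2,\mathbb R)$ be the $n$-dimensional Apollonian group. Then $\mathcal A_n$ is a discrete subgroup of $GL(n+2,\mathbb R)$ for $n=2$ and $n=3$, and it is not a discrete subgroup of $GL(n+2,\mathbb R)$ for all $n\ge4$.
   Context: For $1\le j\le n+2$, $\mathbf S_j=\mathbf I_{n+2}+\frac{2}{n-1}\mathbf e_j\mathbf 1^T-\frac{2n}{n-1}\mathbf e_j\mathbf e_j^T$, where $\mathbf e_j$ is the $j$-th standard column basis vector of $\mathbb{R}^{n+2}$ and $\mathbf 1=(1,\dots,1)^T$. That is, $\mathbf S_j$ agrees with the identity matrix except in row $j$, which has $-1$ on the diagonal and $\frac{2}{n-1}$ in all other positions. The $n$-dimensional Apollonian group $\mathcal A_n$ is the subgroup of $GL(n+2,\mathbb R)$ generated by $\mathbf S_1,\dots,\mathbf S_{n+2}$. *)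

(* Defs.v *)
From HB Require Import structures.
From mathcomp Require Import all_boot all_order all_algebra.
From mathcomp Require Import all_classical all_reals all_analysis.
From mathcomp Require Import ring.

Set Implicit Arguments.
Unset Strict Implicit.
Unset Printing Implicit Defensive.

Import Order.TTheory GRing.Theory Num.Theory.
Import numFieldNormedType.Exports.

Local Open Scope classical_set_scope.
Local Open Scope ring_scope.

Definition GL (R : realType) (m : nat) : set 'M[R]_m :=
  [set A | A \in unitmx].
Arguments GL : clear implicits.

Definition is_subgroup_GL (R : realType) (m : nat) (H : set 'M[R]_m) : Prop :=
  [/\ H `<=` GL R m,
      H 1%:M,
      (forall A B, H A -> H B -> H (A *m B)) &
      (forall A, H A -> H (invmx A))].

Definition generated_subgroup_GL (R : realType) (m : nat) (X : set 'M[R]_m) :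
  set 'M[R]_m := smallest (@is_subgroup_GL R m) X.

(* [isolated] refers to the topology of the ambient matrix space; as GL carries
   the topology induced from that space, this is discreteness of [H] as a
   subset of GL whenever [H `<=` GL R m]. *)
Definition is_discrete_GL (R : realType) (m : nat) (H : set 'M[R]_m) : Prop :=
  forall A, H A -> isolated H A.

Definition apollonian_gen (R : realType) (n : nat) (j : 'I_n.+2) :
    'M[R]_n.+2 :=
  let e : 'cV[R]_n.+2 := delta_mx j 0 in
  let one : 'cV[R]_n.+2 := const_mx 1 in
  1%:M + (2 / (n%:R - 1)) *: (e *m one^T)
       - (2 * n%:R / (n%:R - 1)) *: (e *m e^T).

Definition apollonian_group (R : realType) (n : nat) : set 'M[R]_n.+2 :=
  generated_subgroup_GL (range (@apollonian_gen R n)).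
Arguments apollonian_group : clear implicits.

Lemma apollonian_genE (R : realType) (n : nat) (j i k : 'I_n.+2) :
  (2 <= n)%N ->
  apollonian_gen R j i k =
    if i != j then (i == k)%:R else if k == j then -1 else 2 / (n%:R - 1).
Proof.
move=> n2; have n1 : n%:R - 1 != 0 :> R.
  by rewrite subr_eq0 -[1]/(1%:R) eqr_nat; case: n n2 {j i k} => [|[]].
rewrite /apollonian_gen !mxE !big_ord1 !mxE eqxx !andbT.
case: (eqVneq i j) => [->|_] /=; last by rewrite !mul0r !mulr0 addr0 subr0.
rewrite [j == k]eq_sym; case: (eqVneq k j) => _ /=; last by ring.
by field.
Qed.

(* Main.v *)
Require Import Defs.
From mathcomp Require Import all_boot all_order all_algebra.
From mathcomp Require Import all_classical all_reals all_analysis.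
From mathcomp Require Import ring lra.

(** For n = 2, 3 the generators are integer involutions, so all elements of the
group are integer matrices, and these are at mutual distance at least 1.  For
n >= 4 two generators are reflections, and their product is a rotation of a
plane by the angle 2t with cos t = 1 / (n - 1).  Since 2 cos t is a rational
number that is not an integer, t is not a rational multiple of pi: the powers
of the rotation are all distinct from 1, but by Dirichlet's approximation
theorem they come arbitrarily close to 1. *)

Set Implicit Arguments.
Unset Strict Implicit.
Unset Printing Implicit Defensive.

Import Order.TTheory GRing.Theory Num.Theory.
Import numFieldNormedType.Exports.

Local Open Scope classical_set_scope.
Local Open Scope ring_scope.

(** * Diophantine approximation and angles with rational cosine *)

(** Pigeonhole: with [N > 1 / eps], two of the [N + 1] fractional parts of [k x], [k <= N], fall
    into the same interval of length [1 / N]. As [0 <= x], [Num.truncn] is the floor here. *)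
Lemma dirichlet_approx (R : realType) (x eps : R) :
  0 <= x -> 0 < eps ->
  exists k p : nat, (0 < k)%N /\ `|k%:R * x - p%:R| < eps.
Proof.
move=> x0 eps0.
pose N := (Num.truncn eps^-1).+1.
have N0 : 0 < N%:R :> R by rewrite ltr0n.
have NE : eps^-1 < N%:R by apply: truncnS_gt.
pose fr (k : nat) : R := k%:R * x - (Num.truncn (k%:R * x))%:R.
have frP k : 0 <= fr k < 1.
  have /truncn_itv/andP[] : 0 <= k%:R * x by rewrite mulr_ge0.
  by rewrite /fr -natr1; lra.
have fN k : (Num.truncn (N%:R * fr k) < N)%N.
  have /andP[f0 f1] := frP k.
  rewrite -(ltr_nat R); apply: (@le_lt_trans _ _ (N%:R * fr k)).
    by rewrite truncn_le mulr_ge0 // ltW.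
  by rewrite gtr_pMr.
pose f (i : 'I_N.+1) : 'I_N := Ordinal (fN i).
have [i [j [ij fij]]] : exists i j : 'I_N.+1, (i < j)%N /\ f i = f j.
  have /injectivePn[i [j ij fij]] : ~~ injectiveb f.
    apply/negP => /injectiveP/leq_card.
    by rewrite !card_ord ltnn.
  case: (ltngtP i j) => [lt|lt|/val_inj eij]; last by rewrite eij eqxx in ij.
  - by exists i, j.
  - by exists j, i.
have frE : `|fr j - fr i| < eps.
  have /andP[fi0 _] := frP i; have /andP[fj0 _] := frP j.
  have /truncn_itv/andP[] : 0 <= N%:R * fr i by rewrite mulr_ge0 // ltW.
  have /truncn_itv/andP[] : 0 <= N%:R * fr j by rewrite mulr_ge0 // ltW.
  move/(congr1 val): fij => /= ->; rewrite -natr1 => h1 h2 h3 h4.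
  have : `|N%:R * (fr j - fr i)| < 1 by rewrite ltr_norml; lra.
  rewrite normrM (gtr0_norm N0) -ltr_pdivlMl // mulr1 => /lt_trans; apply.
  by rewrite -[eps]invrK ltf_pV2 ?posrE ?invr_gt0.
(* Both subtractions of naturals are exact: [i < j] and [0 <= x] make the truncations monotone. *)
exists (j - i)%N, (Num.truncn (j%:R * x) - Num.truncn (i%:R * x))%N.
split; first by rewrite subn_gt0.
have ijx : (i : nat)%:R * x <= (j : nat)%:R * x.
  by rewrite ler_wpM2r // ler_nat ltnW.
rewrite !natrB ?(ltnW ij) ?le_truncn //.
by move: frE; congr (`| _ | < _); rewrite /fr; ring.
Qed.

(* u_m = q^m (2 cos m t) satisfies u_(m+2) = p u_(m+1) - q^2 u_m, hence is an
   integer congruent to p^m mod q for m > 0; cos k t = 1 gives u_k = 2 q^k. *)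
Lemma rational_cos_neq1 (R : realType) (p q : nat) (t : R) (k : nat) :
  coprime p q -> (1 < q)%N -> q%:R * (2 * cos t) = p%:R -> (0 < k)%N ->
  cos (k%:R * t) != 1.
Proof.
move=> cpq q1 tE k0.
(* The recurrence has order two, so the induction carries two consecutive terms. The congruence
   leaves out [m = 0], where the term is 2 and not [p ^ 0]. *)
have u_ex m : exists u v : int,
    [/\ q%:R ^+ m * (2 * cos (m%:R * t)) = u%:~R,
        q%:R ^+ m.+1 * (2 * cos (m.+1%:R * t)) = v%:~R,
        (m = 0 \/ (q %| u - p%:Z ^+ m)%Z) & (q %| v - p%:Z ^+ m.+1)%Z].
  elim: m => [|m [u [v [uE vE _ vq]]]].
    exists 2, p; split; rewrite ?expr0 ?expr1 ?mul0r ?cos0 ?mul1r ?subrr ?dvdz0 //.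
    - by rewrite mulr1.
    - by left.
  exists v, (p%:Z * v - q%:Z ^+ 2 * u); split=> //; [|by right|]; last first.
    rewrite (_ : _ - _ = p%:Z * (v - p%:Z ^+ m.+1) - q%:Z * (q%:Z * u)).
      by apply: rpredB; [apply: dvdz_mull | apply: dvdz_mulr].
    by rewrite !exprS; ring.
  rewrite intrB !intrM -uE -vE -[p%:~R]/(p%:R) -tE -[q%:~R]/(q%:R).
  have -> : cos (m.+2%:R * t) = 2 * cos t * cos (m.+1%:R * t) - cos (m%:R * t).
    have -> : m.+2%:R * t = m.+1%:R * t + t by rewrite -[in LHS]natr1; ring.
    have -> : m%:R * t = m.+1%:R * t - t by rewrite -natr1; ring.
    by rewrite cosD cosB; ring.
  by rewrite !exprS; ring.
apply/eqP => c1; have [u [_ [uE _ [k0'|qu] _]]] := u_ex k.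
  by rewrite k0' in k0.
move: uE; rewrite c1 mulr1 -natrX -natrM pmulrn => /intr_inj uE.
(* Now [q] divides both [u] and [u - p ^ k]; coprimality then forces [q] to divide 1. *)
have : (q %| p%:Z ^+ k)%Z.
  rewrite -[_ ^+ _](subKr u); apply: rpredB => //.
  by rewrite -uE -(prednK k0) expnS -mulnA PoszM dvdz_mulr.
rewrite dvdzE abszX !absz_nat.
rewrite -[(p ^ k)%N]muln1 Gauss_dvdr ?coprimeXr ?[coprime q p]coprime_sym //.
by rewrite dvdn1 gtn_eqF.
Qed.

(** * The algebra of two reflections and its rotations *)

Section DihedralAlgebra.
Variables (R : realType) (n : nat) (a : R) (X Y : 'M[R]_n).
Hypothesis XX : X *m X = (-2) *: X.
Hypothesis YY : Y *m Y = (-2) *: Y.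
Hypothesis XYX : X *m Y *m X = a ^+ 2 *: X.
Hypothesis YXY : Y *m X *m Y = a ^+ 2 *: Y.

(* When 1 + X and 1 + Y are reflections generating a dihedral group with a
   nonzero angle, L is -d times the projection onto the plane of rotation, and
   K is a multiple of the rotation of that plane by a right angle. *)
Definition dihedral_sym : 'M[R]_n := 2 *: X + 2 *: Y + X *m Y + Y *m X.
Definition dihedral_skew : 'M[R]_n := X *m Y - Y *m X.

Local Notation L := dihedral_sym.
Local Notation K := dihedral_skew.
Local Notation d := (4 - a ^+ 2).

Let sym_mulX : L *m X = - d *: X.
Proof.
rewrite /L !mulmxDl -!scalemxAl XX -[Y *m X *m X]mulmxA XX XYX -!scalemxAr.
by apply/matrixP => i j; rewrite ![in LHS]mxE ![in RHS]mxE; ring.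
Qed.

Let sym_mulY : L *m Y = - d *: Y.
Proof.
rewrite /L !mulmxDl -!scalemxAl YY -[X *m Y *m Y]mulmxA YY YXY -!scalemxAr.
by apply/matrixP => i j; rewrite ![in LHS]mxE ![in RHS]mxE; ring.
Qed.

Let mulX_sym : X *m L = - d *: X.
Proof.
rewrite /L !mulmxDr -!scalemxAr XX !mulmxA XX XYX -!scalemxAl.
by apply/matrixP => i j; rewrite ![in LHS]mxE ![in RHS]mxE; ring.
Qed.

Let mulY_sym : Y *m L = - d *: Y.
Proof.
rewrite /L !mulmxDr -!scalemxAr YY !mulmxA YY YXY -!scalemxAl.
by apply/matrixP => i j; rewrite ![in LHS]mxE ![in RHS]mxE; ring.
Qed.

(** [L] acts as the scalar [- d] on [X] and [Y] from either side, hence also on [L] and [K]. *)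
Lemma dihedral_sym_sqr : L *m L = - d *: L.
Proof.
rewrite {2}/L !mulmxDr -!scalemxAr !mulmxA !sym_mulX !sym_mulY -!scalemxAl.
by apply/matrixP => i j; rewrite !mxE; ring.
Qed.

Lemma dihedral_sym_skew : L *m K = - d *: K.
Proof.
by rewrite /K mulmxBr !mulmxA sym_mulX sym_mulY -!scalemxAl -scalerBr.
Qed.

Lemma dihedral_skew_sym : K *m L = - d *: K.
Proof.
by rewrite /K mulmxBl -!mulmxA mulX_sym mulY_sym -!scalemxAr -scalerBr.
Qed.

Lemma dihedral_skew_sqr : K *m K = a ^+ 2 *: L.
Proof.
rewrite {2}/K mulmxBr /K !mulmxBl !mulmxA XYX YXY.
rewrite -[X *m Y *m Y]mulmxA YY -[Y *m X *m X]mulmxA XX.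
rewrite -!(scalemxAl, scalemxAr) XYX YXY /L.
by apply/matrixP => i j; rewrite ![in LHS]mxE ![in RHS]mxE; ring.
Qed.

Lemma dihedral_mulE : (1%:M + X) *m (1%:M + Y) = 1%:M + 2^-1 *: L + 2^-1 *: K.
Proof.
rewrite mulmxDl !mulmxDr !mul1mx !mulmx1.
by apply/matrixP => i j; rewrite ![in LHS]mxE ![in RHS]mxE; field.
Qed.

Hypothesis trX : \tr X = -2.
Hypothesis trY : \tr Y = -2.

(** For nonzero [d] the projection [- L / d] thus has trace 2, the dimension of the plane of
    rotation. *)
Lemma dihedral_sym_tr : \tr L = -2 * d.
Proof.
(* Taking traces in [XYX] and rotating the factors gives [-2 tr (X Y) = -2 a ^ 2]. *)
have trXY : \tr (X *m Y) = a ^+ 2.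
  have := congr1 mxtrace XYX.
  rewrite mxtrace_mulC mulmxA XX -scalemxAl !mxtraceZ trX.
  by move=> h; apply: (@mulfI _ (-2)); rewrite ?oppr_eq0 ?pnatr_eq0 // h mulrC.
rewrite /L !mxtraceD !mxtraceZ [\tr (Y *m X)]mxtrace_mulC trXY trX trY; ring.
Qed.

Lemma dihedral_skew_tr : \tr K = 0.
Proof. by rewrite /K raddfB /= mxtrace_mulC subrr. Qed.

Variable t : R.
Hypothesis at2 : a = 2 * cos t.
Hypothesis a0 : a != 0.
Hypothesis st0 : sin t != 0.

(** Put [E = - L / d] and [J = K / (2 a sin t)]. Then [E] is a unit for [J] and [J ^ 2 = - E], and
    the matrix is [(1 - E) + cos x E + sin x J]: the rotation by [x] in the image of [E]. *)
Definition dihedral_rot (x : R) : 'M[R]_n :=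
  1%:M + ((1 - cos x) / d) *: L + (sin x / (a * (2 * sin t))) *: K.

Let dE : d = 4 * sin t ^+ 2.
Proof. by rewrite at2 exprMn cos2sin2; ring. Qed.

Let ct0 : cos t != 0.
Proof. by move: a0; rewrite at2 mulf_eq0 pnatr_eq0. Qed.

Lemma dihedral_rotD x y :
  dihedral_rot x *m dihedral_rot y = dihedral_rot (x + y).
Proof.
rewrite /dihedral_rot !mulmxDl !mulmxDr !mul1mx !mulmx1.
rewrite -!(scalemxAl, scalemxAr) dihedral_sym_sqr dihedral_sym_skew.
rewrite dihedral_skew_sym dihedral_skew_sqr !scalerA.
apply/matrixP => i j; rewrite !(mxE, cosD, sinD) dE at2; field.
by rewrite st0 ct0.
Qed.

(** At the angle [2 t] both coefficients equal 1/2, as in [dihedral_mulE]. *)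
Lemma dihedral_rot1 : dihedral_rot (2 * t) = (1%:M + X) *m (1%:M + Y).
Proof.
rewrite dihedral_mulE /dihedral_rot (_ : 2 * t = t *+ 2) ?mulr_natl //.
rewrite cos_mulr2n sin_mulr2n cos2sin2 dE at2; congr (_ + _ *: _ + _ *: _).
  by field.
by field; rewrite ct0 st0.
Qed.

(** The trace detects whether a rotation is trivial: it equals [n] only if [cos x = 1]. *)
Lemma dihedral_rot_tr x : \tr (dihedral_rot x) = n%:R - 2 * (1 - cos x).
Proof.
rewrite /dihedral_rot !mxtraceD !mxtraceZ mxtrace1 dihedral_sym_tr.
by rewrite dihedral_skew_tr dE; field; rewrite st0.
Qed.

End DihedralAlgebra.

(** * The Apollonian generators as reflections *)

Section ApollonianGen.
Variables (R : realType) (n : nat).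
Hypothesis n2 : (2 <= n)%N.

Local Notation a := (2 / (n%:R - 1) : R).

Let n1 : n%:R - 1 != 0 :> R.
Proof. by rewrite subr_eq0 (eqr_nat R n 1) gtn_eqF. Qed.

(** The rank-one part of the generator, kept as column times row so that products collapse to
    scalars; [2 + a] is [2 n / (n - 1)]. *)
Definition apollonian_root (j : 'I_n.+2) : 'M[R]_n.+2 :=
  delta_mx j 0 *m (a *: const_mx 1 - (2 + a) *: delta_mx 0 j : 'rV_n.+2).

Lemma apollonian_gen_root (j : 'I_n.+2) :
  apollonian_gen R j = 1%:M + apollonian_root j.
Proof.
rewrite /apollonian_gen /apollonian_root trmx_const trmx_delta mulmxBr.
rewrite -!scalemxAr addrA; congr (_ - _ *: _).
by field.
Qed.

(** These scalars, [-2] for [j = k] and [a] otherwise, determine all products and traces of the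
    rank-one parts. *)
Lemma root_form (j k : 'I_n.+2) :
  (a *: const_mx 1 - (2 + a) *: delta_mx 0 j : 'rV[R]_n.+2) *m
    (delta_mx k 0 : 'cV_n.+2) = (a - (2 + a) * (j == k)%:R)%:M.
Proof.
rewrite mulmxBl -!scalemxAl mul_delta_mx_cond -colE.
apply/matrixP => p q; rewrite !ord1 !mxE eqxx mulr1 mulr1n.
by case: (j == k); rewrite ?mulr1n ?mulr0n ?mxE ?mulr1 ?mulr0.
Qed.

Lemma apollonian_root_sqr j :
  apollonian_root j *m apollonian_root j = (-2) *: apollonian_root j.
Proof.
rewrite /apollonian_root mulmxA -[X in X *m _]mulmxA root_form eqxx.
rewrite mul_mx_scalar -scalemxAl; congr (_ *: _); rewrite /= mulr1; ring.
Qed.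

Lemma apollonian_root_braid j k : j != k ->
  apollonian_root j *m apollonian_root k *m apollonian_root j =
  a ^+ 2 *: apollonian_root j.
Proof.
move=> jk.
have mulXX (i l : 'I_n.+2) : apollonian_root i *m apollonian_root l =
    (a - (2 + a) * (i == l)%:R) *: (delta_mx i 0 *m
      (a *: const_mx 1 - (2 + a) *: delta_mx 0 l : 'rV[R]_n.+2)).
  rewrite /apollonian_root mulmxA -[X in X *m _]mulmxA root_form.
  by rewrite mul_mx_scalar -scalemxAl.
rewrite mulXX -scalemxAl /apollonian_root mulmxA -[X in _ *: (X *m _)]mulmxA.
rewrite root_form mul_mx_scalar -scalemxAl scalerA [k == j]eq_sym (negPf jk).
by rewrite /= mulr0 subr0 expr2.
Qed.

Lemma apollonian_root_tr j : \tr (apollonian_root j) = -2.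
Proof.
rewrite mxtrace_mulC root_form eqxx mxtrace_scalar /= mulr1 mulr1n; ring.
Qed.

Lemma apollonian_gen_sqr (j : 'I_n.+2) :
  apollonian_gen R j *m apollonian_gen R j = 1%:M.
Proof.
rewrite apollonian_gen_root mulmxDl !mulmxDr !mul1mx mulmx1.
rewrite apollonian_root_sqr; move: (apollonian_root j) => X.
by apply/matrixP => p q; rewrite !mxE; ring.
Qed.

Lemma apollonian_gen_unit (j : 'I_n.+2) : apollonian_gen R j \in unitmx.
Proof. by case: (mulmx1_unit (apollonian_gen_sqr j)). Qed.

Lemma apollonian_gen_inv (j : 'I_n.+2) :
  invmx (apollonian_gen R j) = apollonian_gen R j.
Proof.
by rewrite -[LHS]mulmx1 -(apollonian_gen_sqr j) mulKmx ?apollonian_gen_unit.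
Qed.

End ApollonianGen.

(** * Discreteness criteria and integrality *)

Lemma generated_subgroup_GL_subgroup (R : realType) (m : nat)
    (X : set 'M[R]_m) :
  X `<=` GL R m -> is_subgroup_GL (generated_subgroup_GL X).
Proof.
move=> XGL; split.
- apply: smallest_sub => //; split=> //.
  + exact: unitmx1.
  + by move=> A B; rewrite /GL /= unitmx_mul => -> ->.
  + by move=> A; rewrite /GL /= unitmx_inv.
- by move=> H [[]].
- by move=> A B HA HB H [sH XH]; case: (sH) => _ _ + _; apply;
    [exact: HA | exact: HB].
- by move=> A HA H [sH XH]; case: (sH) => _ _ _; apply; exact: HA.
Qed.

(** The entrywise unit ball isolates each point, since integers at distance less than 1 are
    equal. *)
Lemma integral_discrete_GL (R : realType) (m : nat) (H : set 'M[R]_m) :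
  (forall A, H A -> A \is a mxOver Num.int) -> is_discrete_GL H.
Proof.
move=> Hint A HA; split; first by rewrite inE.
exists (ball A 1); first exact: nbhsx_ballx.
apply/seteqP; split=> [B [AB HB]|B ->]; last by split=> //; exact: ballxx.
apply/matrixP => i j; apply/eqP; rewrite -subr_eq0.
have intAB : B i j - A i j \is a Num.int.
  by rewrite rpredB // (mxOverP _) // Hint.
apply: contraTT (AB.2 i j) => ABij.
rewrite /ball /= distrC -leNgt; exact: norm_intr_ge1.
Qed.

Lemma nondiscrete_GL (R : realType) (m : nat) (H : set 'M[R]_m) (A : 'M[R]_m) :
  (forall e : R, 0 < e -> exists B, [/\ H B, B != A & ball A e B]) ->
  ~ isolated H A.
Proof.
move=> HA [_ [V /nbhs_ballP[e /= e0 AV] VH]].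
have [B [HB BA AB]] := HA e e0.
have : (V `&` H) B by split=> //; exact: AV.
by rewrite VH /= => eBA; rewrite eBA eqxx in BA.
Qed.

(** Integrality of the inverse is imposed because an invertible integer matrix may have a
    non-integer inverse. *)
Lemma integral_subgroup_GL (R : realType) (m : nat) :
  @is_subgroup_GL R m [set A | [/\ A \in unitmx, A \is a mxOver Num.int &
    invmx A \is a mxOver Num.int]].
Proof.
split=> [A [] //||A B [uA iA iVA] [uB iB iVB]|A [uA iA iVA]] /=.
- have int1 : (1%:M : 'M[R]_m) \is a mxOver Num.int.
    by rewrite mxOver_scalar ?rpred0 ?rpred1.
  by rewrite unitmx1 invmx1.
- rewrite unitmx_mul uA uB mxOverM //; split=> //.
  have -> : invmx (A *m B) = invmx B *m invmx A.
    apply: (can_inj (mulKmx (_ : A *m B \in unitmx))).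
      by rewrite unitmx_mul uA.
    rewrite mulmxV ?unitmx_mul ?uA // -mulmxA [B *m _]mulmxA mulmxV //.
    by rewrite mul1mx mulmxV.
  by rewrite mxOverM.
- by rewrite unitmx_inv invmxK.
Qed.

(** The only entry in doubt, [2 / (n - 1)], is 2 for [n = 2] and 1 for [n = 3]. *)
Lemma apollonian_gen_int (R : realType) (n : nat) (j : 'I_n.+2) :
  n = 2%N \/ n = 3%N -> apollonian_gen R j \is a mxOver Num.int.
Proof.
move=> n23; apply/mxOverP => i k.
rewrite apollonian_genE; last by case: n23 => ->.
case: ifP => _; first exact: rpred_nat.
case: ifP => _; first by rewrite rpredN rpred1.
case: n23 => ->.
  by rewrite (_ : 2 - 1 = 1 :> R) ?divr1 ?rpred_nat //; ring.
by rewrite (_ : 3 - 1 = 2 :> R) ?divff ?pnatr_eq0 //; ring.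
Qed.

(** * Small rotations and the angle for [n >= 4] *)

Lemma dihedral_rot_continuous0 (R : realType) (n : nat) (a : R)
    (X Y : 'M[R]_n) (t : R) :
  dihedral_rot a X Y t x @[x --> 0] --> (1%:M : 'M[R]_n).
Proof.
have -> : (1%:M : 'M[R]_n) = dihedral_rot a X Y t 0.
  by rewrite /dihedral_rot cos0 sin0 subrr !mul0r !scale0r !addr0.
rewrite /dihedral_rot; apply: cvgD; first apply: cvgD; first exact: cvg_cst.
  apply: cvgZr_tmp; apply: cvgMl; apply: cvgB; first exact: cvg_cst.
  exact: continuous_cos.
by apply: cvgZr_tmp; apply: cvgMl; exact: continuous_sin.
Qed.

Lemma apollonian_angle (R : realType) (n : nat) : (4 <= n)%N ->
  exists t : R, [/\ 0 <= t, 2 / (n%:R - 1) = 2 * cos t, sin t != 0 &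
    forall k, (0 < k)%N -> cos (k%:R * t) != 1].
Proof.
move=> n4; pose m := n.-1.
have m3 : (3 <= m)%N by rewrite /m -ltnS prednK ?(leq_trans _ n4).
have mE : n%:R - 1 = m%:R :> R.
  by rewrite /m -subn1 natrB ?(leq_trans _ n4).
have m0 : 0 < m%:R :> R by rewrite ltr0n (leq_trans _ m3).
have m1 : 1 < m%:R :> R by rewrite ltr1n (leq_trans _ m3).
have Vm1 : m%:R^-1 < 1 :> R by rewrite invf_lt1.
have Vm0 : 0 < m%:R^-1 :> R by rewrite invr_gt0.
pose t : R := acos m%:R^-1.
have ct : cos t = m%:R^-1 by rewrite acosK // in_itv /=; lra.
have tE : m%:R * (2 * cos t) = 2 by rewrite ct; field; rewrite gt_eqF.
exists t; split.
- by rewrite acos_ge0 //; lra.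
- by rewrite mE ct.
- rewrite -sqrf_eq0 sin2cos2 ct subr_eq0 gt_eqF //.
  by rewrite expr_lt1 // ltW.
(* In lowest terms [2 cos t] is [2 / m] for odd [m] and [1 / (m / 2)] for even [m]; as [m >= 3], the
   denominator exceeds 1 in both cases. *)
- have [m_odd|m_even] := boolP (odd m) => k.
    apply: (@rational_cos_neq1 _ 2 m) => //; first by rewrite coprime2n.
    by rewrite (leq_trans _ m3).
  have mh : m = (m./2 * 2)%N.
    by rewrite muln2 -[LHS]odd_double_half (negPf m_even).
  apply: (@rational_cos_neq1 _ 1 m./2); first exact: coprime1n.
    by rewrite -(ltn_pmul2r (m := 2)) // -mh.
  apply: (@mulIf _ 2); rewrite ?pnatr_eq0 //.
  by rewrite mul1r -[RHS]tE mh natrM -mh; ring.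
Qed.

Theorem theorem4p1 (R : realType) (n : nat) (hn : (2 <= n)%N) :
  is_subgroup_GL (apollonian_group R n) /\
  ((n = 2%N \/ n = 3%N) -> is_discrete_GL (apollonian_group R n)) /\
  ((4 <= n)%N -> ~ is_discrete_GL (apollonian_group R n)).
Proof.
have grp : is_subgroup_GL (apollonian_group R n).
  apply: generated_subgroup_GL_subgroup => _ [j _ <-].
  exact: apollonian_gen_unit.
split=> //; split=> [n23|n4 disc].
  apply: integral_discrete_GL => A.
  (* By minimality it suffices that the generators, which are their own inverses, lie in the group
     of integer matrices with integer inverse. *)
  suff /[apply] -[] : apollonian_group R n `<=` [set A | [/\ A \in unitmx,
      A \is a mxOver Num.int & invmx A \is a mxOver Num.int]] by [].
  apply: smallest_sub; first exact: integral_subgroup_GL.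
  move=> _ [j _ <-]; split; first exact: apollonian_gen_unit.
    exact: apollonian_gen_int.
  by rewrite apollonian_gen_inv //; exact: apollonian_gen_int.
case: grp => _ G1 GM _; move: (disc _ G1); apply: nondiscrete_GL => e e0.
have [t [t0 at2 st0 ct1]] := apollonian_angle R n4.
pose X := apollonian_root R (ord0 : 'I_n.+2).
pose Y := apollonian_root R (ord_max : 'I_n.+2).
set a := 2 / (n%:R - 1) in at2.
have a0 : a != 0.
  by rewrite mulf_neq0 ?invr_eq0 ?pnatr_eq0 // subr_eq0 (eqr_nat R n 1) gtn_eqF.
have XX : X *m X = (-2) *: X by exact: apollonian_root_sqr.
have YY : Y *m Y = (-2) *: Y by exact: apollonian_root_sqr.
have XYX : X *m Y *m X = a ^+ 2 *: X by exact: apollonian_root_braid.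
have YXY : Y *m X *m Y = a ^+ 2 *: Y by exact: apollonian_root_braid.
have trX : \tr X = -2 by exact: apollonian_root_tr.
have trY : \tr Y = -2 by exact: apollonian_root_tr.
pose rot := dihedral_rot a X Y t.
(* This matrix is the [k]-th power of the product of the two generators. *)
have rotG (k : nat) : apollonian_group R n (rot (k%:R * (2 * t))).
  elim: k => [|k IHk].
    rewrite mul0r /rot /dihedral_rot cos0 sin0 subrr !mul0r !scale0r !addr0.
    exact: G1.
  rewrite -natr1 mulrDl mul1r /rot -dihedral_rotD //; apply: (GM _ _) => //.
  rewrite dihedral_rot1 // -!apollonian_gen_root //.
  by apply: (GM _ _); apply: sub_gen_smallest; eexists.
have /nbhs_ballP[dl /= dl0 rotball] :=
  @dihedral_rot_continuous0 R _ a X Y t _ (nbhsx_ballx _ _ e0).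
have pi2 : 0 < pi *+ 2 :> R by rewrite mulrn_wgt0 // pi_gt0.
(* After scaling by [2 pi], the angle [2 k t] is within [dl] of a multiple of [2 pi]. *)
have [||k [p [k0 kp]]] := @dirichlet_approx R (2 * t / (pi *+ 2)) (dl / (pi *+ 2)).
- by rewrite divr_ge0 ?mulr_ge0 // ltW.
- by rewrite divr_gt0.
exists (rot (k%:R * (2 * t))); split=> //.
  (* If the power were 1, comparing traces would give [cos (2 k t) = 1]. *)
  apply: contraNneq (ct1 (k * 2)%N _) => [/(congr1 mxtrace)|]; last first.
    by rewrite muln_gt0 k0.
  rewrite /rot dihedral_rot_tr // mxtrace1 natrM -mulrA => h.
  by apply/eqP; lra.
(* Reducing the angle modulo [2 pi] leaves the matrix unchanged and brings the angle near 0, where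
   continuity applies. *)
pose x := k%:R * (2 * t) - pi *+ 2 *+ p.
have -> : rot (k%:R * (2 * t)) = rot x.
  rewrite (_ : _ * _ = x + pi *+ 2 *+ p); last by rewrite /x subrK.
  rewrite /rot /dihedral_rot (periodicn (@cosD2pi R)) (periodicn (@sinD2pi R)) //.
apply: rotball; rewrite /ball /= sub0r normrN.
have -> : x = (k%:R * (2 * t / (pi *+ 2)) - p%:R) * (pi *+ 2).
  rewrite mulrBl [p%:R * _]mulr_natl /x; congr (_ - _).
  by rewrite -[RHS]mulrA divfK // gt_eqF.
by rewrite normrM (gtr0_norm pi2) -ltr_pdivlMr.
Qed.
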